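(* There exist absolute constants $c_1,c_2>0$ such that for all integers $k\ge 0$ and $n\ge 1$ with $n>5k$, $$c_1\,2^{-k/2}\ \le\ m_n(k)\ \le\ c_2\left(\frac{\phi}{2}\right)^k .$$
   Context: For integers $a\le b$, $[a,b]$ denotes the set of integers $x$ with $a\le x\le b$. For a set $X$ of integers, $X+X=\{x+y: x,y\in X\}$. Let $A$ be chosen uniformly at random among the $2^n$ subsets of $[0,n-1]$. Set $M_{[0,n-1]}:=|[0,2n-2]\setminus(A+A)|=2n-1-|A+A|$ if $A\neq\emptyset$ (in general, the number of elements of $[0,2n-2]$ not in $A+A$), and $m_n(k):=\mathbb{P}(M_{[0,n-1]}=k)$. Here $\phi=(1+\sqrt5)/2$. *)

(* Defs.v *)
From mathcomp Require Import all_boot all_order all_algebra.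
From mathcomp Require Import reals exp.

Set Implicit Arguments.
Unset Strict Implicit.
Unset Printing Implicit Defensive.

Import Order.TTheory GRing.Theory Num.Theory.

Local Open Scope ring_scope.

(* For n >= 1 the interval [0, 2n-2] is the type 'I_(2 * n - 1); it contains
   every sum of two elements of [0, n-1] = 'I_n, so no sum is lost here. *)
Definition sumset (n : nat) (A : {set 'I_n}) : {set 'I_(2 * n - 1)} :=
  [set s : 'I_(2 * n - 1) |
    [exists x in A, [exists y in A, (x + y == s)%N]]].

Definition missing_sums (n : nat) (A : {set 'I_n}) : nat := #|~: sumset A|.

Definition finunif_prob (R : realType) (T : finType) (E : {set T}) : R :=
  #|E|%:R / #|T|%:R.

Definition missing_prob (R : realType) (n k : nat) : R :=
  finunif_prob R [set A : {set 'I_n} | missing_sums A == k].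

Definition phi (R : realType) : R := (1 + Num.sqrt 5) / 2.

(* Main.v *)
Require Import Defs.
From mathcomp Require Import all_boot all_order all_algebra.
From mathcomp Require Import reals exp.
From mathcomp Require Import zify ring lra.

Set Implicit Arguments.
Unset Strict Implicit.
Unset Printing Implicit Defensive.

Import Order.TTheory GRing.Theory Num.Theory.

(** A subset A of [0, n-1] is read as a bit sequence s of size n; averages over
    the 2^n sequences are taken one bit at a time, so that independence of
    disjoint blocks of bits is the identity [avg_cat].

    Lower bound.  If 0 is not in A, then 0 and 1 are missing and the other sums
    are those of A - 1; hence P(M_n = k + 2) >= P(M_(n-1) = k) / 2, and it is
    enough to bound P(M_n = 0) and P(M_n = 1) from below ([avg_missing_small_ge]).
    Fix the lowest six positions to be all in A (or all but 1, which makes 1 the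
    only missing sum there) and the highest six to be all in A.  A sum 11 + r in
    the bulk is then missing with probability at most (1/32) (3/4)^(r/2), r/2
    being rounded down: at least five of the positions r + 6, ..., r + 11 have to
    be out of A, and the r positions between them and the lowest six form mirror
    pairs that must not lie in A.  Both ends together give at most 1/2.

    Upper bound.  Let z = 5/4; then 1/z = 4/5 < phi/2.  Cut A in two halves.  Some
    sum in the middle range is missing with probability O(n (3/4)^(n/4)), which
    is O((4/5)^k) because n > 5k.  Otherwise M = L + L', where L and L' count the
    missing sums near the two ends and depend on different halves, so that
    P(M = k) is at most z^-k E[z^L] E[z^L'], and it remains to see that E[z^L] is
    bounded ([avg_missing_moment]).  By stripping the leading zeros, each of
    which costs z^2/2 < 1, one may suppose that 0 is in A.  Expand z^L over the
    largest missing sum i that is counted.  Write S and T for the parts of A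
    in the lower and the upper half of [0, i], and let d be the second smallest
    element of A.  All of S, S + d and T consists of sums, so with u sums present
    one has u >= |(S u (S + d)) n lower half| + |T| ([present_ge]).  Since i is
    missing, i - y is not in T when y is in S, and averaging z^-u over T leaves
    a weight on S that couples position y to position y - d only.  Transfer
    along these couplings gains a factor 5/8 per position ([avg_chain]); as
    z^2 (5/8) = 125/128 < 1, the contributions of the i decay geometrically.

    The shift by d is what makes this work: counting only S and T would give the
    factor (1 + 2/z)/4 = 13/20 in place of 5/8, and z^2 (13/20) > 1. *)

(** * Missing sums of bit sequences *)

Local Open Scope nat_scope.

Definition has_sum (s : bitseq) (x : nat) : bool :=
  has (fun y => nth false s y && nth false s (x - y)) (iota 0 x.+1).

Definition missing (s : bitseq) (m : nat) : nat :=
  \sum_(0 <= x < m) ~~ has_sum s x.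

Lemma has_sumP s x :
  reflect (exists y z, [/\ y + z = x, nth false s y & nth false s z])
          (has_sum s x).
Proof.
apply: (iffP hasP) => [[y]|[y [z [<- sy sz]]]].
  rewrite mem_iota /= add0n ltnS => le_yx /andP[sy sz].
  by exists y, (x - y); rewrite subnKC.
exists y; first by rewrite mem_iota /= add0n ltnS leq_addr.
by rewrite sy addKn sz.
Qed.

Lemma eq_has_sum s t x :
  (forall y, y <= x -> nth false s y = nth false t y) ->
  has_sum s x = has_sum t x.
Proof.
move=> eq_st; apply: eq_in_has => y; rewrite mem_iota /= add0n ltnS => le_yx.
by rewrite !eq_st ?leq_subr.
Qed.

Lemma has_sum_catl s t x : x < size s -> has_sum (s ++ t) x = has_sum s x.
Proof.
by move=> lt_xs; apply: eq_has_sum => y le_yx; rewrite nth_cat (leq_ltn_trans le_yx).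
Qed.

Lemma missing_catl s t m : m <= size s -> missing (s ++ t) m = missing s m.
Proof.
move=> le_ms; apply: eq_big_nat => x /andP[_ lt_xm].
by rewrite has_sum_catl // (leq_trans lt_xm).
Qed.

Lemma nth_true_size (s : bitseq) x : nth false s x -> x < size s.
Proof. by rewrite ltnNge; apply: contraL => le_sx; rewrite nth_default. Qed.

(** The reflection y |-> n - 1 - y of [0, n-1] reflects sums in 2n - 2; it turns
    every statement about small sums into one about large sums. *)
Lemma has_sum_rev s x : x <= (size s).*2 - 2 -> 0 < size s ->
  has_sum (rev s) x = has_sum s ((size s).*2 - 2 - x).
Proof.
have main t y : y <= (size t).*2 - 2 -> 0 < size t ->
    has_sum t y -> has_sum (rev t) ((size t).*2 - 2 - y).
  move=> le_y t_gt0 /has_sumP[a [b [ab ta tb]]].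
  have [lt_a lt_b] := (nth_true_size ta, nth_true_size tb).
  apply/has_sumP; exists (size t - a.+1), (size t - b.+1).
  have lt_sub c : c < size t -> size t - c.+1 < size t by move=> _; lia.
  split; first by lia.
    by rewrite nth_rev ?lt_sub // subnSK // subKn // ltnW.
  by rewrite nth_rev ?lt_sub // subnSK // subKn // ltnW.
move=> le_x s_gt0; apply/idP/idP => [sx|].
  by rewrite -[s in has_sum s]revK -(size_rev s); apply: main; rewrite ?size_rev.
by move/main => /(_ (leq_subr _ _) s_gt0); rewrite subKn.
Qed.

Lemma missing_split s m1 m2 : m1 <= m2 ->
  missing s m2 = missing s m1 + \sum_(m1 <= x < m2) ~~ has_sum s x.
Proof. by move=> le_m; rewrite /missing (big_cat_nat _ le_m). Qed.

Lemma missing_le s m : missing s m <= m.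
Proof.
rewrite /missing -[leqRHS]muln1 -[m in m * _]subn0 -sum_nat_const_nat.
by apply: leq_sum => x _; case: (has_sum s x).
Qed.

Lemma missing_rev s m : 0 < size s -> m <= (size s).*2.-1 ->
  \sum_((size s).*2.-1 - m <= x < (size s).*2.-1) ~~ has_sum s x
    = missing (rev s) m.
Proof.
move=> s_gt0 le_m; rewrite big_nat_rev /= -{1}[(size s).*2.-1 - m]add0n big_addn.
rewrite subKn //; apply: eq_big_nat => x /andP[_ lt_xm].
by rewrite has_sum_rev //; last lia; congr (nat_of_bool (~~ has_sum s _)); lia.
Qed.

Lemma has_sum_false s x : has_sum (false :: s) x.+2 = has_sum s x.
Proof.
apply/has_sumP/has_sumP => [[y [z []]]|[y [z [<- sy sz]]]].
  case: y => [|y] //; case: z => [|z] // yz sy sz.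
  by exists y, z; split => //; lia.
by exists y.+1, z.+1; split=> //; lia.
Qed.

(** A set without 0 misses 0 and 1, and its other sums are those of the shifted
    set. *)
Lemma missing_false s m : missing (false :: s) m.+2 = (missing s m).+2.
Proof.
rewrite /missing big_ltn // big_ltn // -[m.+2]addn2 -{1}[2]add0n big_addn addnK.
have -> : has_sum (false :: s) 1 = false by rewrite /has_sum /= andbF.
rewrite /= !add1n; congr _.+2; apply: eq_bigr => x _.
by rewrite addn2 has_sum_false.
Qed.

Fixpoint disj (s t : bitseq) : bool :=
  match s, t with
  | a :: s', b :: t' => ~~ (a && b) && disj s' t'
  | _, _ => true
  end.

Lemma disj_nth s t :
  (forall x, ~~ (nth false s x && nth false t x)) -> disj s t.
Proof.
elim: s t => [|a s IHs] [|b t] //= nst.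
by rewrite (nst 0) IHs // => x; apply: (nst x.+1).
Qed.

Lemma disj_cat s1 s2 t1 t2 : size s1 = size t1 ->
  disj (s1 ++ s2) (t1 ++ t2) = disj s1 t1 && disj s2 t2.
Proof.
by elim: s1 t1 => [|a s1 IHs] [|b t1] //= [/IHs ->]; rewrite andbA.
Qed.

(** For the last index x of v, x is missing exactly when no pair y, x - y lies in
    the set; reversing v aligns the two members of each pair. *)
Lemma no_sum_disj v : ~~ has_sum v (size v).-1 -> disj v (rev v).
Proof.
move=> no_v; apply: disj_nth => x; apply: contra no_v => /andP[vx wx].
have lt_x := nth_true_size vx; apply/has_sumP.
exists x, (size v - x.+1); split=> //; first by lia.
by rewrite nth_rev in wx.
Qed.

(** The indicator of the translate of s by d. *)
Definition shifted (d : nat) (s : bitseq) (y : nat) : bool :=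
  (d <= y) && nth false s (y - d).

(** With 0 and d in S, the sums include S, S + d and the elements T of the upper
    half; here T is listed by t downwards from the top. Only the part of S + d that
    stays in the lower half is counted, so that the contributions are disjoint. *)
Lemma present_ge d s m t :
  nth false s 0 -> (d < size s -> nth false s d) -> size s = size t ->
  missing (s ++ m ++ rev t) (size (s ++ m ++ rev t)) +
    (\sum_(0 <= y < size s) (nth false s y || shifted d s y) + count id t)
  <= size (s ++ m ++ rev t).
Proof.
move=> s0 sd eq_st; set v := s ++ m ++ rev t; set N := size v.
have sizeN : N = size s + (size m + size t).
  by rewrite /N /v !size_cat size_rev.
have v_s x : x < size s -> nth false v x = nth false s x.
  by move=> ltx; rewrite nth_cat ltx.
have s_gt0 := nth_true_size s0.
have v0 : nth false v 0 by rewrite v_s.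
have -> : count id t = \sum_(0 <= y < size t) nth false t y.
  by rewrite -sumn_count sumnE big_map (big_nth false).
have low : \sum_(0 <= y < size s) (nth false s y || shifted d s y)
    <= \sum_(0 <= y < size s) has_sum v y.
  rewrite big_nat_cond [leqRHS]big_nat_cond; apply: leq_sum => y.
  rewrite andbT => /andP[_ lt_ys].
  case: (boolP (_ || _)) => // sy; rewrite lt0b; apply/has_sumP.
  case/orP: sy => [sy | /andP[le_dy sy]].
    by exists 0, y; split; rewrite ?v_s.
  by exists d, (y - d); rewrite subnKC // !v_s ?sd //; lia.
have high : \sum_(0 <= y < size t) nth false t y
    <= \sum_(size s + size m <= y < N) has_sum v y.
  rewrite [leqRHS]big_nat_rev /= -[X in _ <= \sum_(X <= _ < _) _]add0n big_addn.
  have -> : N - (size s + size m) = size t by lia.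
  rewrite big_nat_cond [leqRHS]big_nat_cond; apply: leq_sum => y.
  rewrite andbT => /andP[_ lt_yt]; case: (boolP (nth _ _ _)) => // ty.
  rewrite lt0b; apply/has_sumP; exists 0, (N.-1 - y); split=> //; first by lia.
  rewrite /v catA nth_cat size_cat ltnNge.
  have -> /= : size s + size m <= N.-1 - y by lia.
  by rewrite nth_rev; [congr (is_true (nth _ _ _)): ty|]; lia.
have miss_E k : missing v k + \sum_(0 <= y < k) has_sum v y = k.
  rewrite -big_split /= -[RHS]muln1 -[X in _ = X * _]subn0 -sum_nat_const_nat.
  by apply: eq_bigr => x _; case: (has_sum v x).
rewrite -[leqRHS]miss_E leq_add2l.
rewrite [leqRHS](@big_cat_nat _ _ _ (size s)) //=; last by lia.
rewrite leq_add //.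
rewrite [leqRHS](@big_cat_nat _ _ _ (size s + size m)) //=; [|lia..].
by rewrite (leq_trans high) ?leq_addl.
Qed.

(** * Averages over bit sequences *)

Local Open Scope ring_scope.

(** Recursion on the bits, rather than a sum over a finite type, makes
    conditioning on an initial segment a computation. *)
Fixpoint avg (R : realType) (n : nat) (f : bitseq -> R) : R :=
  if n is m.+1
  then (avg m (fun s => f (true :: s)) + avg m (fun s => f (false :: s))) / 2
  else f [::].

Section Average.
Variable R : realType.
Implicit Types (f g : bitseq -> R) (n m : nat).

Lemma eq_avg n f g :
  (forall s, size s = n -> f s = g s) -> avg n f = avg n g.
Proof.
elim: n f g => [|n IHn] f g eq_fg /=; first exact: eq_fg.
by congr ((_ + _) / 2); apply: IHn => s sz; apply: eq_fg; rewrite /= sz.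
Qed.

Lemma ler_avg n f g :
  (forall s, size s = n -> f s <= g s) -> avg n f <= avg n g.
Proof.
elim: n f g => [|n IHn] f g le_fg /=; first exact: le_fg.
rewrite ler_pM2r ?invr_gt0 ?ltr0n // lerD // IHn // => s sz;
  by apply: le_fg; rewrite /= sz.
Qed.

Lemma avgS n f : avg n.+1 f
  = (avg n (fun s => f (true :: s)) + avg n (fun s => f (false :: s))) / 2.
Proof. by []. Qed.

Lemma avg_const n (c : R) : avg n (fun=> c) = c.
Proof. by elim: n => //= n ->; field. Qed.

Lemma avg_ge0 n f : (forall s, 0 <= f s) -> 0 <= avg n f.
Proof. by move=> f_ge0; rewrite -(avg_const n 0); apply: ler_avg. Qed.

Lemma avgD n f g : avg n (fun s => f s + g s) = avg n f + avg n g.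
Proof. by elim: n f g => //= n IHn f g; rewrite !IHn; field. Qed.

Lemma avgZ n c f : avg n (fun s => c * f s) = c * avg n f.
Proof. by elim: n f => //= n IHn f; rewrite !IHn; field. Qed.

Lemma avgB n f g : avg n (fun s => f s - g s) = avg n f - avg n g.
Proof. by elim: n f g => //= n IHn f g; rewrite !IHn; field. Qed.

Lemma avg_sum n a b (F : nat -> bitseq -> R) :
  avg n (fun s => \sum_(a <= i < b) F i s) = \sum_(a <= i < b) avg n (F i).
Proof.
elim: (index_iota a b) => [|i r IHr].
  rewrite big_nil -[RHS](avg_const n).
  by apply: eq_avg => s _; rewrite big_nil.
rewrite big_cons -IHr -avgD.
by apply: eq_avg => s _; rewrite big_cons.
Qed.

(** Fubini; this is how independence of disjoint sets of positions is used. *)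
Lemma avg_cat m n f :
  avg (m + n) f = avg m (fun s => avg n (fun t => f (s ++ t))).
Proof. by elim: m f => //= m IHm f; rewrite !IHm. Qed.

Lemma avg_rcons n f :
  avg n.+1 f = avg n (fun s => (f (rcons s true) + f (rcons s false)) / 2).
Proof.
rewrite -addn1 avg_cat; apply: eq_avg => s _ /=.
by rewrite !cats1.
Qed.

Lemma avg_rev n f : avg n (fun s => f (rev s)) = avg n f.
Proof.
elim: n f => // n IHn f; rewrite [RHS]avg_rcons -IHn /= -avgD mulrC -avgZ.
by apply: eq_avg => s _; rewrite !rev_cons mulrC.
Qed.

Lemma avg_size_ge n f s : (forall t, 0 <= f t) -> size s = n ->
  f s / 2 ^+ n <= avg n f.
Proof.
elim: s n f => [|b s IHs] [|n] f f_ge0 //=; first by rewrite expr0 divr1.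
case=> sz; have IH := IHs n (fun t => f (b :: t)) (fun t => f_ge0 _) sz.
rewrite exprS invfM mulrCA [2^-1 * _]mulrC.
rewrite ler_pM2r ?invr_gt0 ?ltr0n //.
have pos c : 0 <= avg n (fun t => f (c :: t)) by apply: avg_ge0.
by apply: le_trans IH _; case: b; rewrite ?lerDl ?lerDr.
Qed.

Lemma avg_prefix m (p : bitseq) (c : R) : size p = m ->
  avg m (fun s => (s == p)%:R * c) = c / 2 ^+ m.
Proof.
elim: p m => [|b p IHp] [|m] //=; first by rewrite mul1r expr0 divr1.
have z : avg m (fun=> 0 * c) = 0 by rewrite avg_const mul0r.
case=> sz; have := IHp m sz; rewrite exprS invfM => IH.
case: b => /=.
  rewrite (@eq_avg m (fun s => (false :: s == true :: p)%:R * c) (fun=> 0 * c)).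
    by rewrite z addr0 (@eq_avg m _ (fun s => (s == p)%:R * c)) // IH; ring.
  by [].
rewrite (@eq_avg m (fun s => (true :: s == false :: p)%:R * c) (fun=> 0 * c)) //.
by rewrite z add0r (@eq_avg m _ (fun s => (s == p)%:R * c)) // IH; ring.
Qed.

End Average.

Definition bits n (A : {set 'I_n}) : bitseq := [seq i \in A | i <- enum 'I_n].

Lemma size_bits n (A : {set 'I_n}) : size (bits A) = n.
Proof. by rewrite size_map size_enum_ord. Qed.

Lemma nth_bits n (A : {set 'I_n}) (i : 'I_n) :
  nth false (bits A) i = (i \in A).
Proof.
by rewrite (nth_map i) ?size_enum_ord // nth_ord_enum.
Qed.

Lemma has_sum_bits n (A : {set 'I_n}) (x : 'I_(2 * n - 1)) :
  has_sum (bits A) x = (x \in sumset A).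
Proof.
rewrite inE; apply/has_sumP/exists_inP => [[y [z [yz Ay Az]]]|].
  have := nth_true_size Ay; have := nth_true_size Az.
  rewrite size_bits => lt_z lt_y.
  exists (Ordinal lt_y); first by rewrite -nth_bits.
  apply/exists_inP; exists (Ordinal lt_z); first by rewrite -nth_bits.
  by rewrite /= yz.
case=> y Ay /exists_inP[z Az /eqP yz].
by exists y, z; rewrite !nth_bits.
Qed.

Lemma missing_bits n (A : {set 'I_n}) :
  missing_sums A = missing (bits A) (2 * n - 1).
Proof.
rewrite /missing_sums cardE -sum1_size big_enum big_mkcond /missing big_mkord.
by apply: eq_bigr => x _; rewrite has_sum_bits inE; case: (x \in _).
Qed.

(** An explicit enumeration, used only to identify [avg] with the average over
    the finite type of subsets. *)
Fixpoint bitseqs (n : nat) : seq bitseq :=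
  if n is m.+1
  then [seq true :: s | s <- bitseqs m] ++ [seq false :: s | s <- bitseqs m]
  else [:: [::]].

Lemma sum_bitseqs (R : realType) n (f : bitseq -> R) :
  \sum_(s <- bitseqs n) f s = 2 ^+ n * avg n f.
Proof.
elim: n f => [|n IHn] f /=; first by rewrite big_seq1 expr0 mul1r.
by rewrite big_cat /= !big_map !IHn exprS; field.
Qed.

Lemma mem_bitseqs n s : (s \in bitseqs n) = (size s == n).
Proof.
elim: n s => [|n IHn] [|b s] //=.
  by rewrite mem_cat; apply/negP => /orP[] /mapP[].
rewrite mem_cat eqSS -IHn; apply/orP/idP => [[] /mapP[t tn [_ ->]] //|sn].
by case: b; [left | right]; apply/mapP; exists s.
Qed.

Lemma uniq_bitseqs n : uniq (bitseqs n).
Proof.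
elim: n => //= n IHn; rewrite cat_uniq !map_inj_uniq ?IHn ?andbT //=;
  try by move=> ? ? [].
by apply/hasPn => _ /mapP[s _ ->]; apply/mapP => -[].
Qed.

Lemma perm_bits n : perm_eq [seq bits A | A : {set 'I_n}] (bitseqs n).
Proof.
apply: uniq_perm; rewrite ?uniq_bitseqs //.
  rewrite map_inj_uniq ?enum_uniq // => A B eqAB.
  by apply/setP => i; rewrite -!nth_bits eqAB.
move=> s; rewrite mem_bitseqs; apply/mapP/eqP => [[A _ ->]|sz].
  exact: size_bits.
exists [set i : 'I_n | nth false s i]; first by rewrite mem_enum.
apply: (@eq_from_nth _ false); rewrite ?size_bits sz // => i lt_i.
by rewrite -[i]/(val (Ordinal lt_i)) nth_bits inE.
Qed.

Lemma missing_prob_avg (R : realType) n k :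
  missing_prob R n k = avg n (fun s => (missing s (2 * n - 1) == k)%:R).
Proof.
pose F s : R := (missing s (2 * n - 1) == k)%:R.
have -> : avg n F = (2 ^+ n)^-1 * \sum_(s <- bitseqs n) F s.
  by rewrite sum_bitseqs mulKf // expf_neq0 // pnatr_eq0.
rewrite -(perm_big _ (perm_bits n)) /= big_map big_enum /= mulrC.
rewrite /missing_prob /finunif_prob -cardsT -powersetT card_powerset cardsT.
rewrite card_ord natrX.
congr (_ / _); rewrite -sum1_card natr_sum big_mkcond /=.
by apply: eq_bigr => A _; rewrite /F inE missing_bits; case: (_ == _).
Qed.

(** * The moment of the number of small missing sums *)

Lemma count_nth (a : pred bool) (s : bitseq) :
  count a s = (\sum_(0 <= y < size s) a (nth false s y))%N.
Proof. by rewrite -sumn_count sumnE big_map (big_nth false). Qed.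

Section Estimates.
Variable R : realType.

Lemma sum_geo_le (x : R) n : 0 <= x -> x < 1 ->
  \sum_(0 <= i < n) x ^+ i <= (1 - x)^-1.
Proof.
move=> x0 x1; rewrite -[leRHS]mul1r ler_pdivlMr ?subr_gt0 // big_mkord.
have := subrX1 x n; have : 0 <= x ^+ n by apply: exprn_ge0.
move: (\sum_(i < n) _) (x ^+ n) => S y; nra.
Qed.

(** Each power occurs twice. *)
Lemma sum_geo_half_le (x : R) n : 0 <= x -> x < 1 ->
  \sum_(0 <= i < n) x ^+ i./2 <= 2 / (1 - x).
Proof.
move=> x0 x1.
have E : \sum_(0 <= i < n.*2) x ^+ i./2 = 2 * \sum_(0 <= i < n) x ^+ i.
  elim: n => [|n IHn]; first by rewrite !big_geq ?mulr0.
  rewrite doubleS !big_nat_recr //= IHn doubleK uphalf_double; ring.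
apply: (@le_trans _ _ (\sum_(0 <= i < n.*2) x ^+ i./2)).
  rewrite [leRHS](@big_cat_nat _ _ _ n) //=; last by rewrite -addnn leq_addr.
  by rewrite lerDl sumr_ge0 // => i _; apply: exprn_ge0.
by rewrite E ler_pM2l ?ltr0n // sum_geo_le.
Qed.

(** Where s has a 1 the bit of t must be 0, elsewhere it is free: the sum
    factors over the positions. With w = 4/5 this is the average over the upper
    half, with w = 1 a probability. *)
Lemma avg_disj (w : R) s :
  avg (size s) (fun t => (disj s t)%:R * w ^+ count id t)
    = ((1 + w) / 2) ^+ count negb s * 2^-1 ^+ count id s.
Proof.
elim: s => [|b s IHs] /=; first by rewrite !mul1r.
have z : avg (size s) (fun t => 0 * w ^+ (1 + count id t)) = 0.
  by rewrite (@eq_avg _ _ _ (fun=> 0)) ?avg_const // => t _; rewrite mul0r.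
case: b => /=; rewrite ?z IHs ?exprS; first by field.
rewrite (@eq_avg _ _ _ (fun t => w * ((disj s t)%:R * w ^+ count id t))).
  by rewrite avgZ IHs; field.
by move=> t _; rewrite exprS; ring.
Qed.

Lemma avg_disj1 s :
  avg (size s) (fun t => (disj s t)%:R) = 2^-1 ^+ count id s :> R.
Proof.
have := avg_disj 1 s; have -> : (1 + 1) / 2 = 1 :> R by field.
rewrite expr1n mul1r => <-.
by apply: eq_avg => t _; rewrite expr1n mulr1.
Qed.

(** The pairs of mirror positions are independent, and each avoids (1,1) with
    probability 3/4. *)
Lemma avg_self_disj n :
  avg n (fun s => (disj s (rev s))%:R) <= (3 / 4) ^+ n./2 :> R.
Proof.
have -> : n = (n./2 + (odd n + n./2))%N by rewrite addnCA addnn odd_double_half.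
move: (odd n) (n./2) => c N.
have -> : (N + (c + N))./2 = N by rewrite addnCA addnn half_bit_double.
apply: (@le_trans _ _ (avg N (fun s => 2^-1 ^+ count id s))).
  rewrite avg_cat; apply: ler_avg => s sz; rewrite avg_cat.
  rewrite -[leRHS](avg_const c); apply: ler_avg => m _.
  rewrite -avg_rev -avg_disj1 sz. apply: ler_avg => t szt.
  rewrite !rev_cat revK -catA disj_cat ?sz // ler_nat.
  by case: (disj s t); rewrite //= leq_b1.
elim: N => [|N IHN] /=; first by rewrite expr0.
have -> : avg N (fun s => 2^-1 ^+ (true + count id s))
    = 2^-1 * avg N (fun s => 2^-1 ^+ count id s) :> R.
  by rewrite -avgZ; apply: eq_avg => s _; rewrite exprS.
by rewrite [leRHS]exprS /=; lra.
Qed.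

Lemma avg_no_sum x n : (x < n)%N ->
  avg n (fun s => (~~ has_sum s x)%:R) <= (3 / 4) ^+ x.+1./2 :> R.
Proof.
move=> lt_xn; rewrite -(subnKC lt_xn) avg_cat.
apply: le_trans (avg_self_disj _); apply: ler_avg => s sz.
rewrite -[leRHS](avg_const (n - x.+1)); apply: ler_avg => t _.
rewrite has_sum_catl ?sz // ler_nat; case: (boolP (has_sum s x)) => //= no_x.
by rewrite no_sum_disj ?sz.
Qed.

(** The weight of a lower-half position after averaging over its mirror position:
    c tells whether the position is in S and p whether it is in S + d. Membership
    in the union costs 4/5, a 1 forces the mirror bit to 0 (factor 1/2), and a 0
    leaves it free (factor (1 + 4/5)/2 = 9/10). *)
Definition site (p c : bool) : R :=
  (4 / 5) ^+ (c || p) * (9 / 10) ^+ (~~ c) * 2^-1 ^+ c.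

(** The potential (7/8)^c telescopes along the chains y, y + d, y + 2d, ... The pair
    (1, 7/8) is an approximate eigenvector of the transfer matrix of [site], which
    makes the average of [step p] at most 5/8 for both values of p. *)
Definition step (p c : bool) : R := site p c * (7 / 8) ^+ c * (8 / 7) ^+ p.

Definition chain (F : bool -> bool -> R) (d : nat) (s : bitseq) : R :=
  \prod_(0 <= y < size s) F (shifted d s y) (nth false s y).

Lemma step_ge0 p c : 0 <= step p c.
Proof. by case: p; case: c; rewrite /step /site /= ?expr0 ?expr1; lra. Qed.

Lemma chain_rcons F d s c : (0 < d)%N ->
  chain F d (rcons s c) = chain F d s * F (shifted d s (size s)) c.
Proof.
move=> d_gt0; rewrite /chain size_rcons big_nat_recr //=; congr (_ * F _ _).
- apply: eq_big_nat => y /andP[_ lt_y]; rewrite /shifted !nth_rcons lt_y.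
  by rewrite (leq_ltn_trans (leq_subr _ _) lt_y).
- rewrite /shifted nth_rcons; case: (leqP d (size s)) => //= le_d.
  by rewrite ltn_subrL d_gt0 (leq_trans d_gt0).
- by rewrite nth_rcons ltnn eqxx.
Qed.

Lemma avg_chain d s n : (0 < d)%N ->
  avg n (fun t => chain step d (s ++ t)) <= chain step d s * (5 / 8) ^+ n.
Proof.
move=> d_gt0; elim: n => [|n IHn]; first by rewrite /= cats0 expr0 mulr1.
rewrite avg_rcons exprS mulrCA.
apply: (@le_trans _ _ (avg n (fun t => 5 / 8 * chain step d (s ++ t)))).
  apply: ler_avg => t _; rewrite -!rcons_cat !chain_rcons //.
  set p := shifted _ _ _; rewrite -mulrDr -mulrA mulrC ler_wpM2r //.
    by apply: prodr_ge0 => y _; apply: step_ge0.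
  by case: p; rewrite /step /site /= ?expr0 ?expr1; lra.
by rewrite avgZ ler_pM2l //; lra.
Qed.

Lemma chain_site d s : chain site d s =
  (4 / 5) ^+ (\sum_(0 <= y < size s) (nth false s y || shifted d s y))
  * ((9 / 10) ^+ count negb s * 2^-1 ^+ count id s).
Proof.
rewrite !count_nth -!prodrXr -!big_split /=.
by apply: eq_bigr => y _; rewrite /site mulrA.
Qed.

(** Telescoping leaves the potential of the last d positions only. *)
Lemma site_step d s : (d <= size s)%N ->
  chain site d s <= (8 / 7) ^+ d * chain step d s.
Proof.
move=> le_ds; set a := (\sum_(0 <= y < size s) nth false s y)%N.
set b := (\sum_(0 <= y < size s) shifted d s y)%N.
have -> : chain step d s = chain site d s * (7 / 8) ^+ a * (8 / 7) ^+ b.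
  by rewrite /a /b -!prodrXr /chain -!big_split.
have le_ab : (a <= b + d)%N.
  rewrite /a /b (@big_cat_nat _ _ _ (size s - d)) ?leq_subr //= leq_add //.
    rewrite (@big_cat_nat _ _ _ d 0 (size s)) //=.
    apply: leq_trans (leq_addl _ _).
    rewrite -[X in (_ <= \sum_(X <= _ < _) _)%N]add0n big_addn.
    by apply: leq_sum => y _; rewrite /shifted addnK leq_addl.
  rewrite -[leqRHS]muln1 -[d in (_ <= d * _)%N](subKn le_ds).
  by rewrite -sum_nat_const_nat leq_sum // => y _; case: nth.
have site_ge0 : 0 <= chain site d s.
  apply: prodr_ge0 => y _; case: shifted; case: nth;
  by rewrite /site /= ?expr0 ?expr1; lra.
rewrite -mulrA [(8 / 7) ^+ d * _]mulrCA -[leLHS]mulr1 ler_wpM2l //.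
rewrite mulrCA -exprD addnC -(subnKC le_ab) exprD mulrA -exprMn.
have -> : 7 / 8 * (8 / 7) = 1 :> R by field.
by rewrite expr1n mul1r exprn_ege1 //; lra.
Qed.

(** The weight of the positions before the second element e + 1 of S. *)
Lemma chain_prefix e :
  chain step e.+1 (true :: nseq e false) = 7 / 20 * (9 / 10) ^+ e.
Proof.
rewrite /chain /= size_nseq big_nat_recl //=; congr (_ * _).
  by rewrite /step /site /shifted /= ?expr0 ?expr1; field.
rewrite -[e in RHS]subn0 -prodr_const_nat; apply: eq_big_nat => y /andP[_ lt_y].
rewrite /shifted ltnS leqNgt lt_y /= nth_nseq lt_y.
by rewrite /step /site /= !expr0 expr1; ring.
Qed.

Lemma ler_exp_split a b c : (a + b <= c)%N ->
  (5 / 4) ^+ a <= (5 / 4) ^+ c * (4 / 5) ^+ b :> R.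
Proof.
move=> le_c; rewrite -(subnKC le_c) !exprD.
have inv : (5 / 4) ^+ b * (4 / 5) ^+ b = 1 :> R.
  by rewrite -exprMn (_ : 5 / 4 * (4 / 5) = 1) ?expr1n //; field.
rewrite mulrAC -(mulrA _ _ ((4 / 5) ^+ b)) inv mulr1.
by rewrite ler_peMr ?exprn_ge0 ?exprn_ege1 //; lra.
Qed.

(** Summation over the possible values e + 1 of the second smallest element. The
    prefix and the boundary factor (8/7)^(e+1) cost (144/175)^e relative to
    (5/8)^N, so the sum over e converges.
    When S is the singleton of 0, [index] returns N: the shift N + 1 moves S out of
    the lower half, and this case is the term e = N of the sum. *)
Lemma avg_site N :
  avg N (fun s => chain site (index true s).+1 (true :: s))
    <= 12 / 5 * (5 / 8) ^+ N.
Proof.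
apply: (@le_trans _ _ (avg N (fun s => \sum_(0 <= e < N.+1)
    (take e s == nseq e false)%:R *
      ((8 / 7) ^+ e.+1 * chain step e.+1 (true :: s))))).
  apply: ler_avg => s sz; have le_e : (index true s <= N)%N by rewrite -sz index_size.
  have ge0 e : 0 <= (take e s == nseq e false)%:R *
      ((8 / 7) ^+ e.+1 * chain step e.+1 (true :: s)).
    rewrite !mulr_ge0 ?exprn_ge0 ?divr_ge0 //.
    by apply: prodr_ge0 => y _; apply: step_ge0.
  rewrite big_mkord (bigD1 (Ordinal (le_e : _ < N.+1)%N)) //=.
  have -> : take (index true s) s == nseq (index true s) false.
    by apply/eqP; elim: (s) => [|[] t IHt] //=; rewrite IHt.
  rewrite mul1r; apply: le_trans (site_step _) _; first by rewrite /= sz.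
  by rewrite lerDl sumr_ge0.
rewrite avg_sum.
have bound e : (0 <= e < N.+1)%N ->
    avg N (fun s => (take e s == nseq e false)%:R *
      ((8 / 7) ^+ e.+1 * chain step e.+1 (true :: s)))
    <= 2 / 5 * (5 / 8) ^+ N * (144 / 175) ^+ e.
  rewrite ltnS /= => le_eN; rewrite -{1}(subnKC le_eN) avg_cat.
  apply: (@le_trans _ _ (avg e (fun s => (s == nseq e false)%:R *
     ((8 / 7) ^+ e.+1 * (7 / 20 * (9 / 10) ^+ e * (5 / 8) ^+ (N - e)))))).
    apply: ler_avg => s sz.
    rewrite (@eq_avg _ _ _ (fun t => (s == nseq e false)%:R *
      ((8 / 7) ^+ e.+1 * chain step e.+1 ((true :: s) ++ t)))); last first.
      by move=> t _; rewrite take_size_cat.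
    rewrite avgZ avgZ; case: eqP => [->|_]; last by rewrite !mul0r.
    rewrite !mul1r ler_wpM2l ?exprn_ge0 ?divr_ge0 // -chain_prefix.
    exact: avg_chain.
  (* 144/175 = (8/7) (9/10) (1/2) / (5/8): boundary factor, weight of a zero, and
     probability of a zero, relative to the rate of the chain. *)
  rewrite avg_prefix ?size_nseq // -{2}(subnKC le_eN) exprD.
  have powE : (8 / 7) ^+ e * (9 / 10) ^+ e * 2^-1 ^+ e
      = (5 / 8) ^+ e * (144 / 175) ^+ e :> R.
    by rewrite -!exprMn; congr (_ ^+ _); field.
  rewrite exprS -exprVn; move: powE; move: ((8 / 7) ^+ e) ((9 / 10) ^+ e).
  move: (2^-1 ^+ e) ((5 / 8) ^+ e) ((144 / 175) ^+ e) ((5 / 8) ^+ (N - e)).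
  move=> a b c r x y E; rewrite le_eqVlt; apply/orP; left; apply/eqP.
  rewrite [RHS](_ : _ = 2 / 5 * r * (b * c)); last by ring.
  by rewrite -E; field.
apply: (@le_trans _ _ (\sum_(0 <= e < N.+1)
    2 / 5 * (5 / 8) ^+ N * (144 / 175) ^+ e)); first exact: ler_sum_nat.
(* (2/5) / (1 - 144/175) = 70/31 is below 12/5. *)
rewrite -mulr_sumr mulrAC ler_wpM2r ?exprn_ge0 ?divr_ge0 //.
have := @sum_geo_le (144 / 175) N.+1; set S := \sum_(_ <= _ < _) _.
have -> : (1 - 144 / 175)^-1 = 175 / 31 :> R by field.
move=> le_S; have {le_S} := le_S _ _; lra.
Qed.

(** The contribution of the largest missing sum i for sets that contain 0; c tells
    whether there is a central position, that is, whether i is even. The factor (5/4)^2 (5/8) = 125/128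
    per pair of positions is what has to be smaller than 1. *)
Lemma avg_top_missing N (c : bool) i : i = (N + (c + N.+1))%N ->
  avg i (fun s => (~~ has_sum (true :: s) i)%:R *
                  (5 / 4) ^+ missing (true :: s) i.+1)
    <= 5 * (125 / 128) ^+ N.+1 :> R.
Proof.
move=> iE; set T := i.+1.
apply: (@le_trans _ _ (avg N (fun s =>
    (5 / 4) ^+ T * chain site (index true s).+1 (true :: s)))).
  rewrite [X in avg X]iE avg_cat; apply: ler_avg => s sz; rewrite avg_cat.
  rewrite -[leRHS](avg_const c); apply: ler_avg => m szm.
  rewrite -avg_rev chain_site; set S := true :: s.
  set X := (\sum_(0 <= y < _) _)%N.
  have szS : size S = N.+1 by rewrite /= sz.
  have -> : 9 / 10 = (1 + 4 / 5) / 2 :> R by field.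
  rewrite -avg_disj -!avgZ szS; apply: ler_avg => t szt.
  rewrite -cat_cons -/S; set v := S ++ m ++ rev t.
  have szv : size v = T by rewrite /v !size_cat size_rev szS szm szt /T iE.
  have no_disj : ~~ has_sum v i -> disj S t.
    have -> : i = (size v).-1 by rewrite szv.
    move/no_sum_disj; rewrite /v !rev_cat revK -!catA disj_cat ?szS //.
    by case/andP.
  have le_T : (missing v T + (X + count id t) <= T)%N.
    rewrite -szv; apply: present_ge; rewrite ?szS //.
    rewrite /= ltnS -{1}sz index_mem => s1.
    exact: nth_index.
  case: has_sum no_disj => /= [_|/(_ isT) ->].
    by rewrite mul0r !mulr_ge0 ?exprn_ge0 ?divr_ge0 ?ler0n.
  by rewrite !mul1r -exprD ler_exp_split.
have E : T = (c + N.+1 * 2)%N by rewrite /T iE; lia.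
have lt_c : (5 / 4) ^+ c <= 5 / 4 :> R by case: (c); rewrite ?expr0 ?expr1; lra.
rewrite avgZ E exprD [(N.+1 * 2)%N]mulnC exprM.
have := avg_site N; set A := avg _ _ => le_A.
have -> : (125 / 128) ^+ N.+1 = ((5 / 4) ^+ 2) ^+ N.+1 * ((5 / 8) * (5 / 8) ^+ N) :> R.
  by rewrite -exprS -exprMn; congr (_ ^+ _); field.
have A_ge0 : 0 <= A by apply: avg_ge0 => s; apply: prodr_ge0 => y _;
  case: shifted; case: nth; rewrite /site /= ?expr0 ?expr1; lra.
have le_cA := ler_pM (exprn_ge0 _ _) A_ge0 lt_c le_A.
set P := _ ^+ N.+1; have P_ge0 : 0 <= P by rewrite /P -exprM exprn_ge0 ?divr_ge0.
rewrite [leLHS](_ : _ = P * ((5 / 4) ^+ c * A)); last by rewrite mulrAC mulrC.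
rewrite [leRHS]mulrCA ler_wpM2l //; apply: le_trans (le_cA _) _; first by lra.
have : 0 <= (5 / 8) ^+ N :> R by rewrite exprn_ge0 //; lra.
by lra.
Qed.

(** Sets that contain 0: either no sum is missing, or one expands over the largest
    missing one. *)
Lemma avg_missing_moment_true h :
  avg h (fun s => (5 / 4) ^+ missing (true :: s) h.+1) <= 428 :> R.
Proof.
have pointwise (v : bitseq) n : (5 / 4) ^+ missing v n <=
    1 + \sum_(0 <= i < n) (~~ has_sum v i)%:R * (5 / 4) ^+ missing v i.+1 :> R.
  elim: n => [|n IHn]; first by rewrite /missing !big_geq // addr0.
  rewrite big_nat_recr //= addrA.
  case: (boolP (has_sum v n)) => v_n /=.
    rewrite mul0r addr0; apply: le_trans IHn.
    by rewrite /missing big_nat_recr //= v_n addn0.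
  rewrite mul1r lerDr addr_ge0 // sumr_ge0 // => i _.
  by rewrite mulr_ge0 ?ler0n ?exprn_ge0 ?divr_ge0.
apply: (@le_trans _ _ (avg h (fun s => 1 + \sum_(0 <= i < h.+1)
    (~~ has_sum (true :: s) i)%:R * (5 / 4) ^+ missing (true :: s) i.+1))).
  by apply: ler_avg => s _; apply: pointwise.
rewrite avgD avg_const avg_sum.
apply: (@le_trans _ _ (1 + \sum_(0 <= i < h.+1) 5 * (125 / 128) ^+ i./2)).
  rewrite lerD2l; apply: ler_sum_nat => i /=; rewrite ltnS => le_ih.
  case: i le_ih => [_|i le_ih].
    rewrite (@eq_avg _ _ _ (fun=> 0)).
      by rewrite avg_const mulr_ge0 ?exprn_ge0 ?divr_ge0.
    by move=> s _; rewrite /has_sum /= mul0r.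
  set N := i./2; set c := odd i.
  have iE : i.+1 = (N + (c + N.+1))%N by rewrite -[i in LHS]odd_double_half -/c -/N; lia.
  rewrite -(subnKC le_ih) avg_cat.
  apply: le_trans (le_trans (avg_top_missing iE) _).
    apply: ler_avg => s sz; rewrite -[leRHS](avg_const (h - i.+1)).
    apply: ler_avg => t _; have szS : size (true :: s) = i.+2 by rewrite /= sz.
    by rewrite -cat_cons has_sum_catl ?missing_catl ?szS.
  rewrite ler_pM2l // -[leRHS]/((125 / 128) ^+ uphalf i) uphalf_half -/c -/N exprD exprS.
  rewrite ler_wpM2r ?exprn_ge0 //; first by lra.
  by case: (c); rewrite ?expr0 ?expr1; lra.
rewrite -mulr_sumr; have := @sum_geo_half_le (125 / 128) h.+1.
set S := \sum_(_ <= _ < _) _; have -> : 2 / (1 - 125 / 128) = 256 / 3 :> R by field.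
by move=> le_S; have {le_S} := le_S _ _; lra.
Qed.

(** A leading 0 adds two missing sums and has probability 1/2; this recursion is
    contracting because (5/4)^2 / 2 < 1. *)
Lemma avg_missing_moment h : avg h (fun s => (5 / 4) ^+ missing s h) <= 1000 :> R.
Proof.
elim: h => [|h IHh] /=; first by rewrite /missing big_geq // expr0; lra.
have le_f : avg h (fun s => (5 / 4) ^+ missing (false :: s) h.+1)
    <= (5 / 4) ^+ 2 * avg h (fun s => (5 / 4) ^+ missing s h) :> R.
  rewrite -avgZ; apply: ler_avg => s _; rewrite -exprD ler_eXn2l; last by lra.
  case: h {IHh} => [|h]; first by rewrite (leq_trans (missing_le _ _)).
  by rewrite missing_false !ltnS [leqRHS](missing_split _ (leqnSn h)) leq_addr.
have := avg_missing_moment_true h.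
by rewrite expr2 in le_f; lra.
Qed.

End Estimates.

(** * The upper bound *)

Section Upper.
Variable R : realType.

Lemma avg_no_middle_sum n x : (0 < n)%N -> (n./2 <= x < n + n./2 - 1)%N ->
  avg n (fun s => (~~ has_sum s x)%:R) <= (3 / 4) ^+ (n./2.+1)./2 :> R.
Proof.
move=> n_gt0 /andP[le_hx lt_x].
have mono m : (n./2 <= m)%N -> (3 / 4) ^+ m.+1./2 <= (3 / 4) ^+ (n./2.+1)./2 :> R.
  by move=> le_m; rewrite ler_wiXn2l ?half_leq ?ltnS //; lra.
case: (ltnP x n) => [lt_xn|le_nx].
  by apply: le_trans (avg_no_sum R lt_xn) (mono _ le_hx).
rewrite -avg_rev (@eq_avg _ _ _ (fun s => (~~ has_sum s (n.*2 - 2 - x))%:R)).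
  by apply: le_trans (avg_no_sum R _) (mono _ _); lia.
by move=> s sz; rewrite has_sum_rev sz //; lia.
Qed.

(** Bernoulli for (83/75)^q, where 83/75 is the quotient of 83/100 and 3/4. *)
Lemma linear_geo_le q : (4 * q + 1)%:R * (3 / 4) ^+ q <= 38 * (83 / 100) ^+ q :> R.
Proof.
have [x0 y0] : 0 <= (3 / 4) ^+ q :> R /\ 0 <= (8 / 75) *+ q :> R.
  by rewrite mulrn_wge0 ?exprn_ge0 ?divr_ge0.
have bern : 1 + (8 / 75) *+ q <= (83 / 75) ^+ q :> R.
  elim: (q) => [|m IHm]; first by rewrite mulr0n addr0 expr0.
  have m0 : 0 <= (8 / 75) *+ m :> R by rewrite mulrn_wge0 ?divr_ge0.
  by rewrite exprS mulrS; lra.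
have -> : (83 / 100) ^+ q = (83 / 75) ^+ q * (3 / 4) ^+ q :> R.
  by rewrite -exprMn; congr (_ ^+ _); field.
rewrite mulrA ler_wpM2r // natrD natrM.
have qE : (8 / 75) *+ q = 8 / 75 * q%:R :> R by rewrite mulr_natr.
have q0 : 0 <= q%:R :> R by [].
by rewrite qE in bern; lra.
Qed.

(** Holds because (83/100)^5 < (4/5)^4. *)
Lemma geo_exponent_le k q : (5 * k <= 4 * q)%N -> (83 / 100) ^+ q <= (4 / 5) ^+ k :> R.
Proof.
move=> le_kq; rewrite -(ler_pXn2r (n := 5)) ?nnegrE ?exprn_ge0 ?divr_ge0 //.
rewrite -!exprM ![(_ * 5)%N]mulnC.
apply: (@le_trans _ _ ((4 / 5) ^+ (4 * q))); last by rewrite ler_wiXn2l //; lra.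
by rewrite !exprM lerXn2r ?nnegrE ?exprn_ge0 ?divr_ge0 //; lra.
Qed.

(** Exponential Markov inequality for the two ends, union bound for the middle. *)
Lemma avg_missing_le n k : (0 < n)%N -> (5 * k < n)%N ->
  avg n (fun s => (missing s (2 * n - 1) == k)%:R)
    <= (1000 * 1000 + 38) * (4 / 5) ^+ k :> R.
Proof.
move=> n_gt0 lt_kn; set h := n./2; set q := h.+1./2.
have n_q : (n <= 4 * q + 1)%N by rewrite /q /h; lia.
(* The upper half has h2 positions, one more than the lower when n is odd. *)
have [h2 nE] : {h2 | n = (h + h2)%N}.
  by exists (n - h)%N; rewrite /h; lia.
have le_h : (h <= h2)%N by lia.
pose mid s : R := \sum_(h <= x < n + h - 1) (~~ has_sum s x)%:R.
pose ends s t : R := (5 / 4) ^+ missing s h * (5 / 4) ^+ missing (rev t) h2.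
have pointwise s t : size s = h -> size t = h2 ->
    (missing (s ++ t) (2 * n - 1) == k)%:R
      <= mid (s ++ t) + (4 / 5) ^+ k * ends s t.
  move=> szs szt; set v := s ++ t.
  have szv : size v = n by rewrite size_cat szs szt.
  have ends_ge0 : 0 <= (4 / 5) ^+ k * ends s t by rewrite !mulr_ge0 ?exprn_ge0 ?divr_ge0.
  have mid_ge0 : 0 <= mid v by apply: sumr_ge0 => x _; apply: ler0n.
  case: eqP => [kE|_]; last exact: addr_ge0.
  set midn := (\sum_(h <= x < n + h - 1) ~~ has_sum v x)%N.
  have mE : missing v (2 * n - 1) = (missing s h + midn + missing (rev t) h2)%N.
    rewrite (@missing_split _ h); last by lia.
    rewrite -addnA; congr (_ + _)%N; first by rewrite missing_catl ?szs.
    rewrite (@big_cat_nat _ _ _ (n + h - 1)) /=; [|lia..].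
    congr (_ + _)%N; have -> : missing (rev t) h2 = missing (rev v) h2.
      by rewrite rev_cat missing_catl ?size_rev ?szt.
    rewrite -missing_rev szv //; last by lia.
    by congr (\sum_(_ <= _ < _) _)%N; lia.
  (* One missing middle sum already makes the middle term at least 1; without any,
     k is the number of missing sums at the two ends. *)
  case: (posnP midn) => [mid0|mid_gt0]; last first.
    have one_le : 1 <= mid v by rewrite /mid -natr_sum -/midn ler1n.
    by apply: le_trans one_le _; rewrite lerDl.
  rewrite -kE mE mid0 addn0 exprD mulrACA -!exprMn.
  have -> : 4 / 5 * (5 / 4) = 1 :> R by field.
  by rewrite !expr1n mulr1 lerDr.
have main : avg n (fun s => (missing s (2 * n - 1) == k)%:R)
    <= avg n mid + (4 / 5) ^+ k *
       (avg h (fun s => (5 / 4) ^+ missing s h)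
        * avg h2 (fun s => (5 / 4) ^+ missing s h2)).
  rewrite [X in avg X _ <= _]nE [X in avg X mid]nE !avg_cat.
  have -> : avg h (fun s => (5 / 4) ^+ missing s h)
      * avg h2 (fun s => (5 / 4) ^+ missing s h2)
      = avg h (fun s => avg h2 (ends s)) :> R.
    rewrite mulrC -avgZ; apply: eq_avg => s _.
    by rewrite mulrC -avg_rev -avgZ.
  rewrite -avgZ -avgD; apply: ler_avg => s szs.
  by rewrite -avgZ -avgD; apply: ler_avg => t szt; apply: pointwise.
apply: le_trans main _; rewrite [leLHS]addrC [leRHS]mulrDl lerD //.
  rewrite mulrC ler_wpM2r ?exprn_ge0 ?divr_ge0 //.
  by apply: ler_pM; rewrite ?avg_missing_moment //;
    apply: avg_ge0 => s; rewrite exprn_ge0 ?divr_ge0.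
apply: (@le_trans _ _ (38 * (83 / 100) ^+ q)); last first.
  by rewrite ler_wpM2l // geo_exponent_le //; lia.
apply: le_trans (linear_geo_le q); rewrite avg_sum.
apply: (@le_trans _ _ (\sum_(h <= x < n + h - 1) (3 / 4) ^+ q)).
  by apply: ler_sum_nat => x hx; apply: avg_no_middle_sum.
rewrite sumr_const_nat -[leLHS]mulr_natl ler_wpM2r ?exprn_ge0 ?divr_ge0 //.
by rewrite ler_nat; lia.
Qed.

End Upper.

(** * The lower bound *)

Lemma has_sum_cat_sub s t x : has_sum s x -> has_sum (s ++ t) x.
Proof.
case/has_sumP => y [z [yz sy sz]]; apply/has_sumP; exists y, z.
by rewrite !nth_cat !nth_true_size.
Qed.

(** A sufficient condition for n - 6 + i to be a sum: it is 0 or 1 from the lower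
    fringe P plus an element of the upper fringe Q. *)
Definition fringe_sum (P Q : bitseq) (i : nat) : bool :=
  nth false P 0 && nth false Q i
  || [&& (0 < i)%N, nth false P 1 & nth false Q i.-1].

(** The sums below n are found in three ranges: inside the lower fringe, in the
    bulk (by hypothesis), and from 0 or 1 plus the upper fringe. *)
Lemma fringe_has_sum P t Q x : size P = 6 -> size Q = 6 ->
  ((x < 11)%N -> has_sum P x) ->
  (forall r, r + 6 <= size t -> has_sum (P ++ t) (11 + r))%N ->
  (forall i, (i < 6)%N -> (size t + 6 + i)%N = x -> fringe_sum P Q i) ->
  (x < size t + 12)%N -> has_sum (P ++ t ++ Q) x.
Proof.
move=> szP szQ low mid high lt_x; set v := P ++ t ++ Q.
case: (ltnP x 11) => [/low/has_sum_cat_sub|le_11]; first by apply.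
case: (ltnP x (size t + 6)) => [lt_xt|le_tx].
  rewrite /v catA has_sum_cat_sub // -(subnKC le_11) mid //; lia.
have [i xE lt_i] : exists2 i, (size t + 6 + i)%N = x & (i < 6)%N.
  by exists (x - (size t + 6))%N; lia.
have v_t j : nth false v (size t + 6 + j) = nth false Q j.
  rewrite /v catA nth_cat size_cat szP addnC [(size t + 6)%N]addnC ltnNge leq_addl.
  by rewrite addnK.
have v_P j : (j < 6)%N -> nth false v j = nth false P j.
  by move=> lt_j; rewrite /v nth_cat szP lt_j.
have /orP[/andP[P0 Qi]|/and3P[i_gt0 P1 Qi]] := high _ lt_i xE; apply/has_sumP.
  by exists 0, x; rewrite v_P // -xE v_t.
by exists 1, (size t + 6 + i.-1)%N; rewrite v_P // v_t; split => //; lia.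
Qed.

Section Lower.
Variable R : realType.

(** The ones of P force at least five zeros among the top six bits, and the r bits
    between must avoid (1,1) in mirror pairs. *)
Lemma avg_fringe_miss P r n : size P = 6 -> (5 <= count id P)%N -> (r + 6 <= n)%N ->
  avg n (fun t => (~~ has_sum (P ++ t) (11 + r))%:R) <= 1 / 32 * (3 / 4) ^+ r./2 :> R.
Proof.
move=> szP P5 le_n; rewrite -(subnKC le_n) !avg_cat.
apply: (@le_trans _ _ (1 / 32 * avg r (fun s => (disj s (rev s))%:R))); last first.
  by rewrite ler_wpM2l ?avg_self_disj //; lra.
rewrite -avgZ; apply: ler_avg => s szs; rewrite -avg_rev.
apply: (@le_trans _ _ ((disj s (rev s))%:R * avg 6 (fun t => (disj P t)%:R))).
  rewrite -avgZ; apply: ler_avg => t szt.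
  rewrite -[leRHS](avg_const (n - (r + 6))); apply: ler_avg => u _.
  set v := P ++ s ++ rev t; have szv : size v = (12 + r)%N.
    by rewrite !size_cat size_rev szP szs szt; lia.
  rewrite catA -/v has_sum_catl ?szv // -natrM ler_nat mulnb.
  case: (boolP (has_sum v _)) => //= no_v; rewrite lt0b.
  have := @no_sum_disj v; rewrite szv => /(_ no_v).
  rewrite /v !rev_cat revK -catA disj_cat ?szP ?szt // disj_cat ?size_rev //.
  by case/and3P => -> ->.
rewrite mulrC; have := avg_disj1 R P; rewrite szP => ->; rewrite ler_wpM2r //.
have -> : 1 / 32 = 2^-1 ^+ 5 :> R by rewrite exprVn -natrX div1r.
by rewrite ler_wiXn2l //; lra.
Qed.

(** {0,2,3,4,5} misses only the sum 1 in [0, 10], and [0, 5] misses none. *)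
Definition fringe (b : bool) : bitseq := [:: true, ~~ b & nseq 4 true].

(** The lower half of the sums is read from s, the upper half from its reversal,
    whose lower fringe is full and whose upper fringe has a possible hole. *)
Lemma missing_fringe b t : let s := fringe b ++ t ++ nseq 6 true in
  (forall r, r + 6 <= size t -> has_sum (fringe b ++ t) (11 + r))%N ->
  (forall r, r + 6 <= size t -> has_sum (nseq 6 true ++ rev t) (11 + r))%N ->
  missing s (2 * size s - 1) = b.
Proof.
move=> s mid1 mid2; have szs : size s = (size t + 12)%N.
  by rewrite /s !size_cat /=; lia.
have s_gt0 : (0 < size s)%N by rewrite szs addn_gt0 orbT.
rewrite (@missing_split _ (size s)); last by lia.
have -> : (\sum_(size s <= x < 2 * size s - 1) ~~ has_sum s x = 0)%N.
  transitivity (missing (rev s) (size s).-1).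
    by rewrite -missing_rev //; [congr (\sum_(_ <= _ < _) _)%N|]; lia.
  apply: big1_seq => x; rewrite mem_index_iota => /andP[_ lt_x].
  apply/eqP; rewrite eqb0 negbK /s !rev_cat -catA rev_nseq.
  apply: fringe_has_sum; rewrite ?size_rev ?size_cat ?size_nseq //.
  - by clear lt_x; do 11!case: x => [|x] //.
  - by case: (b) => i; do 6!case: i => [|i] //.
  - by move: lt_x; rewrite szs; lia.
have s1 x : (x < size s)%N -> has_sum s x = ~~ (b && (x == 1)).
  move=> lt_x; case: (boolP (b && _)) => [/andP[b1 /eqP ->]|bx].
    by rewrite /s b1 has_sum_catl.
  apply: fringe_has_sum; rewrite ?size_nseq //; last by rewrite -szs.
    by clear lt_x; case: (b) bx; do 11!case: x => [|x] //.
  by case: (b) => i; do 6!case: i => [|i] //.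
rewrite addn0 /missing (@eq_big_nat _ _ _ _ _ _ (fun x => b && (x == 1) : nat)).
  rewrite szs big_ltn ?addn_gt0 ?orbT // big_ltn; last by lia.
  rewrite andbF andbT big1_seq ?addn0 // => x.
  by rewrite mem_index_iota => /andP[_ /andP[x2 _]]; rewrite gtn_eqF ?andbF.
by move=> x /andP[_ lt_x]; rewrite s1 // negbK.
Qed.

(** For n < 12 one explicit set is enough. *)
Lemma avg_missing_small_ge (b : bool) n : (0 < n)%N -> (5 * b < n)%N ->
  2^-1 ^+ 13 <= avg n (fun s => (missing s (2 * n - 1) == b)%:R) :> R.
Proof.
move=> n_gt0 lt_bn; case: (ltnP n 12) => [lt_n|le_n].
  set s := take n (fringe b ++ nseq 6 true).
  have szs : size s = n by rewrite size_take /=; case: ltnP; lia.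
  have miss_s : missing s (2 * n - 1) == b.
    rewrite /s /missing unlock; clear s szs.
    by move: n_gt0 lt_n; case: (b) lt_bn; do 12!case: n => [|n] //.
  apply: le_trans (avg_size_ge _ szs) => [|t]; last by rewrite ler0n.
  by rewrite miss_s mul1r -exprVn ler_wiXn2l ?invr_ge0 ?invf_le1 ?ler1n // ltnW // ltnW.
rewrite -(subnKC le_n); move: (n - 12)%N => j {n n_gt0 lt_bn le_n}.
pose bad P r t : R := (~~ has_sum (P ++ t) (11 + r))%:R.
pose F t : R := (missing (fringe b ++ t ++ nseq 6 true)
                   (2 * (12 + j) - 1) == b)%:R.
(* The two fringes are 12 prescribed bits; the j bits between them are free. *)
apply: (@le_trans _ _ (avg j F / 2 ^+ 12)); last first.
  have jE : (12 + j = 6 + (j + 6))%N by lia.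
  rewrite jE.
  have step1 := @avg_size_ge R 6 (fun s => avg (j + 6) (fun t =>
    (missing (s ++ t) (2 * (6 + (j + 6)) - 1) == b)%:R)) (fringe b).
  rewrite avg_cat; apply: le_trans (step1 _ _) => //; last first.
    by move=> t; apply: avg_ge0 => u; apply: ler0n.
  rewrite (exprD _ 6 6) invfM mulrA ler_pM2r ?invr_gt0 ?exprn_gt0 //.
  rewrite avg_cat mulrC -avgZ; apply: ler_avg => t szt; rewrite mulrC.
  have step2 := @avg_size_ge R 6 (fun u =>
    (missing (fringe b ++ t ++ u) (2 * (6 + (j + 6)) - 1) == b)%:R) (nseq 6 true).
  apply: le_trans (step2 _ _) => //.
  by rewrite /F jE.
have le_F : avg j (fun t => 1 - (\sum_(0 <= r < j - 5) bad (fringe b) r t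
    + \sum_(0 <= r < j - 5) bad (nseq 6 true) r (rev t))) <= avg j F.
  apply: ler_avg => t szt.
  have bad_ge0 P u : 0 <= \sum_(0 <= r < j - 5) bad P r u.
    by apply: sumr_ge0 => r _; apply: ler0n.
  have bad_ge1 P u r : (r + 6 <= j)%N -> ~~ has_sum (P ++ u) (11 + r) ->
      1 <= \sum_(0 <= r < j - 5) bad P r u.
    move=> le_r no_r; have lt_r : (r < j - 5)%N by lia.
    rewrite big_mkord (bigD1 (Ordinal lt_r)) //= /bad no_r lerDl.
    by apply: sumr_ge0 => i _; apply: ler0n.
  have F_ge0 : 0 <= F t by apply: ler0n.
  have [all1|/allPn[r]] := boolP (all (fun r => has_sum (fringe b ++ t) (11 + r))
      (iota 0 (j - 5))); last first.
    rewrite mem_iota => lt_r /bad_ge1; have := bad_ge0 (nseq 6 true) (rev t).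
    by move=> ? /(_ ltac:(lia)) ?; lra.
  have [all2|/allPn[r]] := boolP (all (fun r => has_sum (nseq 6 true ++ rev t) (11 + r))
      (iota 0 (j - 5))); last first.
    rewrite mem_iota => lt_r /bad_ge1; have := bad_ge0 (fringe b) t.
    by move=> ? /(_ ltac:(lia)) ?; lra.
  have F1 : F t = 1.
    rewrite /F; have -> : (12 + j)%N = size (fringe b ++ t ++ nseq 6 true).
      by rewrite !size_cat /= szt; lia.
    rewrite missing_fringe ?eqxx // => r le_r;
      [apply: (allP all1) | apply: (allP all2)]; by rewrite mem_iota; lia.
  by rewrite F1 lerBlDr lerDl addr_ge0.
have sum_bad P : size P = 6 -> (5 <= count id P)%N ->
    \sum_(0 <= r < j - 5) avg j (bad P r) <= 1 / 4.
  move=> szP P5; apply: (@le_trans _ _ (\sum_(0 <= r < j - 5) 1 / 32 * (3 / 4) ^+ r./2)).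
    by apply: ler_sum_nat => r lt_r; apply: avg_fringe_miss => //; lia.
  rewrite -mulr_sumr; have := @sum_geo_half_le R (3 / 4) (j - 5).
  set S := \sum_(_ <= _ < _) _; have -> : 2 / (1 - 3 / 4) = 8 :> R by field.
  by move=> le_S; have {le_S} := le_S _ _; lra.
move: le_F; rewrite avgB avg_const avgD avg_sum.
rewrite (@avg_rev _ _ (fun t => \sum_(0 <= r < j - 5) bad (nseq 6 true) r t)) avg_sum.
have := sum_bad (fringe b) erefl; have := sum_bad (nseq 6 true) erefl isT.
move=> b1 b2 le_F; have {}b2 := b2 ltac:(by case: (b)).
have -> : 2^-1 ^+ 13 = 1 / 2 / 2 ^+ 12 :> R by rewrite exprVn exprS invfM div1r.
rewrite ler_pM2r ?invr_gt0 ?exprn_gt0 //.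
by apply: le_trans le_F; lra.
Qed.

(** Prepending a 0 adds two missing sums at the cost of a factor 1/2, and lowers n
    by 1 only, so that the condition n > 5k is kept. *)
Lemma avg_missing_ge n k : (0 < n)%N -> (5 * k < n)%N ->
  2^-1 ^+ 13 * 2^-1 ^+ k./2 <= avg n (fun s => (missing s (2 * n - 1) == k)%:R) :> R.
Proof.
elim/ltn_ind: k n => -[|[|k]] IHk n n_gt0 lt_kn.
- by rewrite expr0 mulr1; apply: (@avg_missing_small_ge false).
- by rewrite expr0 mulr1; apply: (@avg_missing_small_ge true).
case: n n_gt0 lt_kn => [|[|n]] // _ lt_kn.
have lt_k : (5 * k < n.+1)%N by lia.
have IH := IHk k (leqnSn k.+1) n.+1 isT lt_k.
rewrite [k.+2./2]/= [_ ^+ _.+1 in X in _ * X]exprS avgS.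
have -> : (2 * n.+2 - 1 = (2 * n.+1 - 1).+2)%N by lia.
set A := avg n.+1 (fun s => (_ (true :: s) _ == _)%:R).
have A_ge0 : 0 <= A by apply: avg_ge0 => s; apply: ler0n.
rewrite (@eq_avg _ n.+1 (fun s => (missing (false :: s) _ == _)%:R)
  (fun s => (missing s (2 * n.+1 - 1) == k)%:R)).
  by lra.
by move=> s _; rewrite missing_false !eqSS.
Qed.

End Lower.

(** * The theorem *)

Theorem theorem1p2 (R : realType) :
  exists c1 c2 : R, [/\ 0 < c1, 0 < c2 &
    forall k n : nat, (1 <= n)%N -> (5 * k < n)%N ->
      c1 * 2 `^ (- (k%:R / 2)) <= missing_prob R n k /\
      missing_prob R n k <= c2 * (phi R / 2) ^+ k].
Proof.
exists (2^-1 ^+ 13), (1000 * 1000 + 38); split=> [||k n n_gt0 lt_kn].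
- by rewrite exprn_gt0 ?invr_gt0.
- by rewrite addr_gt0 ?mulr_gt0.
rewrite missing_prob_avg; split.
  apply: le_trans (avg_missing_ge R n_gt0 lt_kn).
  rewrite ler_wpM2l ?exprn_ge0 ?invr_ge0 // exprVn -powR_mulrn // -powRN.
  rewrite ler_powR ?ler1n // lerN2 ler_pdivlMr // -natrM ler_nat; lia.
apply: le_trans (avg_missing_le R n_gt0 lt_kn) _.
rewrite ler_wpM2l ?addr_ge0 ?mulr_ge0 // lerXn2r ?nnegrE ?divr_ge0 //.
  by rewrite /phi addr_ge0 ?sqrtr_ge0.
have : 11 / 5 <= Num.sqrt 5 :> R.
  rewrite -(ler_pXn2r (n := 2)) ?nnegrE ?sqrtr_ge0 ?divr_ge0 // sqr_sqrtr //.
  by rewrite expr2; lra.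
by rewrite /phi; lra.
Qed.
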